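(* Let $G$ be a totally ordered abelian group, $K$ a field, $S$ a proper submonoid of $G_{\geq 0}$, and let $D := [[K^S]] \subsetneq V := [[K^{G_{\geq 0}}]]$. Assume that $D$ and $V$ have the same quotient field. Take $a \in G_{\geq 0} \setminus S$. The following conditions are equivalent: (1) $D$ is maximal with respect to excluding the element $X^a$. (2) For every $g \in G$ with $g \neq \frac{a}{2}$, one has $X^g \in D$ if and only if $X^{a-g} \notin D$.
   Context: $G$ is written additively, $\boldsymbol{0}$ is its identity and $G_{\geq 0}$ is the monoid of elements $\geq \boldsymbol{0}$. For a submonoid $S \subseteq G_{\geq 0}$ containing $\boldsymbol{0}$, the generalized power series ring $[[K^S]]$ is the set of maps $f: S \to K$ whose support $\{s \in S : f(s) \neq 0\}$ contains no infinite strictly descending sequence, with pointwise addition and convolution product $(fh)(s)=\sum_{u+w=s} f(u)h(w)$; it is an integral domain, and (extending by zero) a subring of $V=[[K^{G_{\geq 0}}]]$. $V$ is a valuation domain with value group $G$, the value of $f\neq 0$ being the minimum of its support. $X^s$ denotes the monomial with value $1$ at $s$ and $0$ elsewhere; for $g<\boldsymbol{0}$, $X^g := (X^{-g})^{-1}$ in the quotient field of $V$. The condition $g\neq \frac a2$ means $2g \neq a$. An overring of $D$ is a ring between $D$ and its quotient field. $D$ is maximal with respect to excluding $y$ if $y$ is in the quotient field of $D$, $y\notin D$, and every overring of $D$ strictly containing $D$ contains $y$. *)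

(* Defs.v *)
From HB Require Import structures.
From mathcomp Require Import all_boot all_order all_algebra.
From mathcomp Require Import boolp classical_sets functions cardinality fsbigop.

Set Implicit Arguments.
Unset Strict Implicit.
Unset Printing Implicit Defensive.

Import Order.TTheory GRing.Theory.
Local Open Scope classical_set_scope.
Local Open Scope ring_scope.

HB.mixin Record POrderedZmodule_isTotallyOrdered G of Num.POrderedZmodule G := {
  oag_le_total : total (<=%O : rel G);
  oag_leD2l : forall x y z : G, x <= y -> z + x <= z + y
}.

(* The order of a [porderZmodType] need not be compatible with the addition.
   [orderType] is not inherited: with a [zmodType] it would need a structure
   that [realDomainType] inherits from. *)
#[short(type="oagType")]
HB.structure Definition OrderedAbelianGroup :=
  { G of Num.POrderedZmodule G & POrderedZmodule_isTotallyOrdered G }.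

Section Submonoids.
Variable G : oagType.

Definition nonneg : set G := [set g | 0 <= g].

Definition submonoid (S : set G) : Prop :=
  S 0 /\ forall x y : G, S x -> S y -> S (x + y).

Definition no_infinite_descent (A : set G) : Prop :=
  ~ exists u : nat -> G, forall n, A (u n) /\ u n.+1 < u n.

End Submonoids.
Arguments nonneg {G}.

Section OrderFacts.
Variable G : oagType.
Implicit Types (x y z : G) (A B : set G).

Lemma oag_ltNge x y : (x < y) = ~~ (y <= x).
Proof. by rewrite comparable_ltNge //; exact: oag_le_total. Qed.

Lemma oag_leNgt x y : (x <= y) = ~~ (y < x).
Proof. by rewrite oag_ltNge negbK. Qed.

Lemma oag_leD x y z w : x <= y -> z <= w -> x + z <= y + w.
Proof.
move=> xy zw; apply: (le_trans (oag_leD2l z w x zw)).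
by rewrite (addrC x) (addrC y); exact: oag_leD2l.
Qed.

Lemma oag_leDl x y z : (z + x <= z + y) = (x <= y).
Proof.
apply/idP/idP; last exact: oag_leD2l.
by move=> /(oag_leD2l _ _ (- z)); rewrite !addKr.
Qed.

Lemma oag_ltDl x y z : (z + x < z + y) = (x < y).
Proof. by rewrite !oag_ltNge oag_leDl. Qed.

Lemma oag_leN x y : (- x <= - y) = (y <= x).
Proof. by rewrite -(oag_leDl (- x) (- y) (x + y)) addrK addrAC subrr add0r. Qed.

Lemma oag_ltN x y : (- x < - y) = (y < x).
Proof. by rewrite !oag_ltNge oag_leN. Qed.

Lemma sub_no_infinite_descent A B :
  A `<=` B -> no_infinite_descent B -> no_infinite_descent A.
Proof.
move=> AB hB [u hu]; apply: hB; exists u => n.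
by have [/AB ? ?] := hu n; split.
Qed.

Lemma no_infinite_descent_min A B : no_infinite_descent A -> B `<=` A ->
  B !=set0 -> exists2 m, B m & forall b, B b -> m <= b.
Proof.
move=> hA BA [b0 Bb0]; apply: contrapT => hn; apply: hA.
have /choice[F hF] : forall b, exists b', B b -> B b' /\ b' < b.
  move=> b; case: (pselect (B b)) => [Bb|]; last by exists b.
  apply: contrapT => h; apply: hn; exists b => // c Bc.
  by rewrite oag_leNgt; apply/negP => cb; apply: h; exists c.
have hB n : B (iter n F b0) by elim: n => //= n /hF[].
by exists (fun n => iter n F b0) => n; split; [exact: BA | have [] := hF _ (hB n)].
Qed.

Lemma min_max_finite A :
  (forall B, B `<=` A -> B !=set0 -> exists2 m, B m & forall b, B b -> m <= b) ->
  (forall B, B `<=` A -> B !=set0 -> exists2 m, B m & forall b, B b -> b <= m) ->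
  finite_set A.
Proof.
move=> hmin hmax.
have hP a : A a -> finite_set (A `&` [set x | x <= a]).
  apply: contrapT; apply: contra_notP => _.
  pose C := [set b | A b /\ infinite_set (A `&` [set x | x <= b])].
  case: (pselect (C !=set0)) => [C0|C0]; last first.
    by move=> Aa; apply: contrapT => ha; apply: C0; exists a.
  have [|m [Am infm] mmin] := hmin C _ C0; first by move=> ? [].
  exfalso; apply: infm.
  have lt_m : A `&` [set x | x <= m] `<=` (A `&` [set x | x < m]) `|` [set m].
    move=> x [Ax]; rewrite /= le_eqVlt => /orP[/eqP ->|]; first by right.
    by left.
  apply: (sub_finite_set lt_m); rewrite finite_setU; split; last exact: finite_set1.
  case: (pselect (A `&` [set x | x < m] !=set0)) => [ne|]; last first.
    by move=> /set0P/negP; rewrite negbK => /eqP ->; exact: finite_set0.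
  have [|k [Ak km] kmax] := hmax _ _ ne; first by move=> ? [].
  have finK : finite_set (A `&` [set x | x <= k]).
    apply: contrapT => infK; have := mmin k (conj Ak infK).
    by rewrite oag_leNgt => /negP; apply.
  by apply: sub_finite_set finK => x [Ax xm]; split => //; apply: kmax.
case: (pselect (A !=set0)) => [ne|]; last first.
  by move=> /set0P/negP; rewrite negbK => /eqP ->; exact: finite_set0.
have [m Am mmax] := hmax A (@subset_refl _ A) ne.
by apply: sub_finite_set (hP m Am) => x Ax; split => //; exact: mmax.
Qed.

Lemma finite_sum_fiber A B s : no_infinite_descent A -> no_infinite_descent B ->
  finite_set [set u | A u /\ B (s - u)].
Proof.
move=> hA hB; apply: min_max_finite => C CAB C0.
  by apply: (no_infinite_descent_min hA) => // x /CAB[].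
pose C' := [set w | C (s - w)].
have [||w Cw wmin] := @no_infinite_descent_min _ C' hB.
- by move=> w /CAB[_]; rewrite subKr.
- by case: C0 => x Cx; exists (s - x); rewrite /C' /= subKr.
exists (s - w) => // b Cb.
by rewrite -oag_leN opprB -(oag_leDl _ _ s) addrC subrK; apply: wmin; rewrite /C' /= subKr.
Qed.

Lemma add_no_infinite_descent A B :
  no_infinite_descent A -> no_infinite_descent B ->
  no_infinite_descent [set s | exists u w, [/\ A u, B w & u + w = s]].
Proof.
move=> hA hB [s hs].
have /choice[u hu] : forall n, exists u, A u /\ B (s n - u).
  move=> n; have [[u [w [Au Bw <-]]] _] := hs n.
  by exists u; split => //; rewrite addrAC subrr add0r.
have /choice[F hF] : forall n, exists m, (n <= m)%N /\
    forall k, (n <= k)%N -> u m <= u k.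
  move=> n.
  have [||x [m nm <-] hm] :=
      @no_infinite_descent_min _ [set u k | k in [set k | (n <= k)%N]] hA.
  - by move=> _ [k _ <-]; have [] := hu k.
  - by exists (u n); exists n => /=.
  by exists m; split => // k nk; apply: hm; exists k.
have sdec i j : (i < j)%N -> s j < s i.
  elim: j => // j IH; rewrite ltnS leq_eqVlt => /orP[/eqP ->|/IH].
    by have [] := hs j.
  by apply: lt_trans; have [] := hs j.
pose phi := fix phi n := if n is n'.+1 then F (phi n').+1 else F 0%N.
have phiS n : (phi n < phi n.+1)%N by have [] := hF (phi n).+1.
have uphi n : u (phi n) <= u (phi n.+1).
  case: n => [|n]; first by have [_] := hF 0%N; apply.
  have [_ h] := hF (phi n).+1; apply: h.
  exact: (ltn_trans (phiS n) (phiS n.+1)).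
apply: hB; exists (fun n => s (phi n) - u (phi n)) => n; split.
  by have [] := hu (phi n).
apply: (@lt_le_trans _ _ (s (phi n) - u (phi n.+1))).
  by rewrite !(addrC _ (- u _)) oag_ltDl; exact: sdec.
by rewrite oag_leDl oag_leN.
Qed.

End OrderFacts.

Section PowerSeries.
Variables (G : oagType) (K : fieldType).

(* A map S -> K is represented by its extension by zero to G. *)
Definition power_series (S : set G) : set (G -> K) :=
  [set f | [set s | f s != 0] `<=` S /\ no_infinite_descent [set s | f s != 0]].

(* On [power_series] the sum has finitely many nonzero terms
   (see [finite_convolution]); \sum_(_ \in _) returns 0 otherwise. *)
Definition convolution (f h : G -> K) (s : G) : K :=
  \sum_(p \in [set p : G * G | p.1 + p.2 = s]) f p.1 * h p.2.

Lemma convolutionE f h s :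
  convolution f h s = \sum_(u \in [set: G]) f u * h (s - u).
Proof.
rewrite /convolution (reindex_fsbig (fun u => (u, s - u)) [set: G]) //.
split => [u _ /=|u v _ _ [->]//|[u w] /= <-]; first by rewrite addrC subrK.
by exists u => //; rewrite addrAC subrr add0r.
Qed.

Lemma convolution_widen f h s (A : set G) :
  (forall u, f u != 0 -> h (s - u) != 0 -> A u) ->
  convolution f h s = \sum_(u \in A) f u * h (s - u).
Proof.
move=> hA; rewrite convolutionE; apply/esym/fsbig_widen => // u [_ nAu] /=.
apply/eqP; rewrite mulf_eq0; apply/orP.
have [|fu] := eqVneq (f u) 0; first by left.
have [|hu] := eqVneq (h (s - u)) 0; first by right.
by case: nAu; exact: hA.
Qed.

Lemma finite_convolution (f h : G -> K) s : no_infinite_descent [set s | f s != 0] ->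
  no_infinite_descent [set s | h s != 0] -> finite_set
  [set p : G * G | p.1 + p.2 = s /\ f p.1 * h p.2 != 0].
Proof.
move=> hf hh; have /= fin := finite_sum_fiber s hf hh.
apply: sub_finite_set (finite_image (fun u => (u, s - u)) fin) => -[u w] /= [<-].
rewrite mulf_eq0 negb_or => /andP[fu hw]; exists u; rewrite addrAC subrr add0r //.
Qed.

Lemma convolution_neq0 (f h : G -> K) s : convolution f h s != 0 ->
  exists u w, [/\ f u != 0, h w != 0 & u + w = s].
Proof.
move=> /(fsbigN1 (f := fun=> fun p : G * G => f p.1 * h p.2) (x := s)).
move=> [[u w] /= <-]; rewrite mulf_eq0 negb_or => /andP[fu hw].
by exists u, w.
Qed.

Lemma power_series_convolution S f h : submonoid S ->
  power_series S f -> power_series S h -> power_series S (convolution f h).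
Proof.
move=> [_ SD] [fS fd] [hS hd]; split=> [s|].
  by move=> /convolution_neq0[u [w [fu hw <-]]]; apply: SD; [exact: fS|exact: hS].
apply: sub_no_infinite_descent (add_no_infinite_descent fd hd) => s /=.
by move=> /convolution_neq0[u [w [fu hw <-]]]; exists u, w.
Qed.

Lemma power_series0 S : power_series S (fun=> 0).
Proof.
split=> [s|[u hu]]; first by rewrite /= eqxx.
by have [] := hu 0%N; rewrite /= eqxx.
Qed.

Lemma power_seriesN S f : power_series S f -> power_series S (fun s => - f s).
Proof.
move=> [fS fd]; split=> [s|]; first by rewrite /= oppr_eq0; exact: fS.
by apply: sub_no_infinite_descent fd => s /=; rewrite oppr_eq0.
Qed.

Lemma no_infinite_descentU (A B : set G) : no_infinite_descent A ->
  no_infinite_descent B -> no_infinite_descent (A `|` B).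
Proof.
move=> hA hB [u hu].
have udec i j : (i < j)%N -> u j < u i.
  elim: j => // j IH; rewrite ltnS leq_eqVlt => /orP[/eqP ->|/IH].
    by have [] := hu j.
  by apply: lt_trans; have [] := hu j.
have [||m [_ [n _ un]] hm] := @no_infinite_descent_min _ A (A `&` range u) hA.
- exact: subIsetl.
- apply: contrapT => hn; apply: hB; exists u => n; have [[Au|//] ?] := hu n.
  by case: hn; exists (u n); split => //; exists n.
apply: hB; exists (fun k => u (n + k).+1) => k.
have [[Au|Bu] dec] := hu (n + k).+1; last by rewrite addnS.
have := hm (u (n + k).+1); rewrite oag_leNgt -un udec ?ltnS ?leq_addr //.
by move=> h; have := h (conj Au (ex_intro2 _ _ _ I erefl)).
Qed.

Lemma power_seriesD S f h : power_series S f -> power_series S h ->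
  power_series S (fun s => f s + h s).
Proof.
move=> [fS fd] [hS hd].
have sub : [set s | f s + h s != 0] `<=` [set s | f s != 0] `|` [set s | h s != 0].
  move=> s /=; have [->|] := eqVneq (f s) 0; last by left.
  by rewrite add0r; right.
split; first by move=> s /sub[]; [exact: fS|exact: hS].
exact: sub_no_infinite_descent sub (no_infinite_descentU fd hd).
Qed.

Definition delta (g : G) : G -> K := fun s => (s == g)%:R.

Lemma power_series_delta (S : set G) g : S g -> power_series S (delta g).
Proof.
move=> Sg; have dE s : delta g s != 0 -> s = g.
  by rewrite /delta; case: (eqVneq s g) => //; rewrite mulr0n eqxx.
split=> [s /dE -> //|[u hu]].
have [/dE u0 lt10] := hu 0%N; have [/dE u1 _] := hu 1%N.
by move: lt10; rewrite u0 u1 ltxx.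
Qed.

Lemma convolutionC f h : convolution f h = convolution h f.
Proof.
apply/funext => s; rewrite [LHS]/convolution.
rewrite (reindex_fsbig (fun p : G * G => (p.2, p.1)) [set p | p.1 + p.2 = s]).
  by apply: eq_fsbigr => p _ /=; rewrite mulrC.
split => [[u w] /= <-|[u w] [u' w'] _ _ [-> ->]//|[u w] /= <-].
- by rewrite addrC.
- by exists (w, u); rewrite //= addrC.
Qed.

Lemma convolution1 f : convolution (delta 0) f = f.
Proof.
apply/funext => s; rewrite (@convolution_widen _ _ _ [set 0]).
  by rewrite fsbig_set1 /delta eqxx mul1r subr0.
by move=> u; rewrite /delta; case: (eqVneq u 0) => //; rewrite mulr0n eqxx.
Qed.

Lemma convolutionDl f1 f2 h : no_infinite_descent [set s | f1 s != 0] ->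
  no_infinite_descent [set s | f2 s != 0] ->
  no_infinite_descent [set s | h s != 0] ->
  convolution (fun s => f1 s + f2 s) h =
  (fun s => convolution f1 h s + convolution f2 h s).
Proof.
move=> d1 d2 dh; apply/funext => s.
pose A := [set u | (f1 u != 0 \/ f2 u != 0) /\ h (s - u) != 0].
have finA : finite_set A.
  exact: finite_sum_fiber (no_infinite_descentU d1 d2) dh.
rewrite !(@convolution_widen _ _ _ A); first last.
- move=> u; have [->|] := eqVneq (f1 u) 0; last by split => //; left.
  by rewrite add0r; split => //; right.
- by move=> u; split => //; left.
- by move=> u; split => //; right.
by rewrite -fsbig_split //; apply: eq_fsbigr => u _; rewrite mulrDl.
Qed.

Lemma convolutionA f g h : no_infinite_descent [set s | f s != 0] ->
  no_infinite_descent [set s | g s != 0] ->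
  no_infinite_descent [set s | h s != 0] ->
  convolution f (convolution g h) = convolution (convolution f g) h.
Proof.
move=> df dg dh; apply/funext => s.
pose sumset (A B : set G) := [set s | exists u w, [/\ A u, B w & u + w = s]].
pose P := [set v | sumset [set s | f s != 0] [set s | g s != 0] v /\ h (s - v) != 0].
have finP : finite_set P.
  exact: finite_sum_fiber (add_no_infinite_descent df dg) dh.
pose Q := [set u | f u != 0 /\
  sumset [set s | g s != 0] [set s | h s != 0] (s - u)].
have finQ : finite_set Q.
  exact: finite_sum_fiber df (add_no_infinite_descent dg dh).
rewrite (@convolution_widen f _ _ Q); last first.
  by move=> u fu /convolution_neq0 ?; split.
rewrite (@convolution_widen _ h _ P); last first.
  by move=> v /convolution_neq0 ? ?; split.
transitivity (\sum_(u \in Q) \sum_(v \in P) f u * (g (v - u) * h (s - v))).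
  apply: eq_fsbigr => u /set_mem[fu _]; rewrite convolutionE.
  rewrite mulr_fsumr (reindex_fsbigT (fun v => v - u)); last first.
    by exists (fun v => v + u) => v; rewrite ?subrK ?addrK.
  rewrite -(@fsbig_widen _ _ _ _ P) //; last first.
    move=> v [_ nPv] /=; apply/eqP; rewrite !mulf_eq0.
    apply: contra_notT nPv; rewrite !negb_or => /and3P[_ gv hv]; split.
      by exists u, (v - u); split => //; rewrite addrC subrK.
    by move: hv; rewrite opprB addrA subrK.
  by apply: eq_fsbigr => v _; rewrite opprB addrA subrK.
rewrite exchange_fsbig //; apply: eq_fsbigr => v /set_mem[_ hv].
rewrite (@convolution_widen f g _ Q); last first.
  move=> u fu gu; split => //; exists (v - u), (s - v); split => //.
  by rewrite addrC addrA subrK.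
by rewrite mulr_fsuml; apply: eq_fsbigr => u _; rewrite mulrA.
Qed.

Lemma convolution_min f h a b :
  (forall s, f s != 0 -> a <= s) -> (forall s, h s != 0 -> b <= s) ->
  convolution f h (a + b) = f a * h b.
Proof.
move=> ha hb; rewrite (@convolution_widen _ _ _ [set a]).
  by rewrite fsbig_set1 addrAC subrr add0r.
move=> u /ha au /hb bu; apply/le_anti; rewrite au andbT.
have e : u - b + (a + b - u) = a by rewrite addrC -addrA addKr addrK.
by have := oag_leD2l _ _ (u - b) bu; rewrite subrK e.
Qed.

End PowerSeries.

Section Nonneg.
Variables (G : oagType) (K : fieldType).

Lemma nonneg_submonoid : submonoid (@nonneg G).
Proof.
split=> [|x y x0 y0]; first exact: lexx.
by have := oag_leD x0 y0; rewrite add0r.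
Qed.

(* The ring V = [[K^{G_{>= 0}}]]. *)
Record gpseries := GPSeries {
  coef :> G -> K;
  _ : coef \in power_series nonneg
}.

HB.instance Definition _ := [isSub for coef].
HB.instance Definition _ := [Choice of gpseries by <:].

Implicit Types f g h : gpseries.

Lemma coefP f : power_series nonneg f.
Proof. by case: f => f /= /set_mem. Qed.

Lemma coef_descent f : no_infinite_descent [set s | f s != 0].
Proof. by case: (coefP f). Qed.

Definition mk_gpseries (f : G -> K) (hf : power_series nonneg f) : gpseries :=
  GPSeries (mem_set hf).

Definition gp_zero := mk_gpseries (@power_series0 G K nonneg).
Definition gp_one :=
  mk_gpseries (@power_series_delta G K nonneg 0 (lexx 0)).
Definition gp_opp f := mk_gpseries (power_seriesN (coefP f)).
Definition gp_add f h := mk_gpseries (power_seriesD (coefP f) (coefP h)).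
Definition gp_mul f h := mk_gpseries
  (power_series_convolution nonneg_submonoid (coefP f) (coefP h)).

Lemma gpseriesP f h : (forall s, f s = h s) -> f = h.
Proof. by move=> fh; apply: val_inj; apply/funext. Qed.

Fact gp_addA : associative gp_add.
Proof. by move=> f g h; apply: gpseriesP => s /=; rewrite addrA. Qed.
Fact gp_addC : commutative gp_add.
Proof. by move=> f g; apply: gpseriesP => s /=; rewrite addrC. Qed.
Fact gp_add0 : left_id gp_zero gp_add.
Proof. by move=> f; apply: gpseriesP => s /=; rewrite add0r. Qed.
Fact gp_addN : left_inverse gp_zero gp_opp gp_add.
Proof. by move=> f; apply: gpseriesP => s /=; rewrite addNr. Qed.

HB.instance Definition _ :=
  GRing.isZmodule.Build gpseries gp_addA gp_addC gp_add0 gp_addN.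

Fact gp_mulA : associative gp_mul.
Proof.
move=> f g h; apply: val_inj => /=.
by apply: convolutionA; exact: coef_descent.
Qed.
Fact gp_mulC : commutative gp_mul.
Proof. by move=> f g; apply: val_inj; exact: convolutionC. Qed.
Fact gp_mul1 : left_id gp_one gp_mul.
Proof. by move=> f; apply: val_inj; exact: convolution1. Qed.
Fact gp_mulDl : left_distributive gp_mul +%R.
Proof.
move=> f g h; apply: val_inj => /=.
by apply: convolutionDl; exact: coef_descent.
Qed.
Fact gp_one_neq0 : gp_one != 0.
Proof.
apply/eqP => /(congr1 (fun f : gpseries => f 0)) /eqP.
by rewrite /= /delta eqxx oner_eq0.
Qed.

HB.instance Definition _ := GRing.Zmodule_isComNzRing.Build gpseries
  gp_mulA gp_mulC gp_mul1 gp_mulDl gp_one_neq0.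

Lemma gp_coef0 s : (0 : gpseries) s = 0. Proof. by []. Qed.
Lemma gp_coefN f s : (- f) s = - f s. Proof. by []. Qed.
Lemma gp_coefD f h s : (f + h) s = f s + h s. Proof. by []. Qed.
Lemma gp_coef1 : coef 1 = delta K 0. Proof. by []. Qed.
Lemma gp_coefM f h : coef (f * h) = convolution f h. Proof. by []. Qed.

Definition gp_unit : {pred gpseries} :=
  [pred f : gpseries | `[< exists h : gpseries, h * f = 1 >]].
Definition gp_inv f : gpseries :=
  if pselect (exists h : gpseries, h * f = 1) is left e
  then projT1 (cid e) else f.

Fact gp_mulVx : {in gp_unit, left_inverse 1 gp_inv *%R}.
Proof.
move=> f /asboolP uf; rewrite /gp_inv; case: pselect => // e.
by case: (cid e).
Qed.
Fact gp_unitPl f h : h * f = 1 -> gp_unit f.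
Proof. by move=> hf; apply/asboolP; exists h. Qed.
Fact gp_inv_out : {in [predC gp_unit], gp_inv =1 id}.
Proof.
by move=> f /asboolP nuf; rewrite /gp_inv; case: pselect.
Qed.

HB.instance Definition _ := GRing.ComNzRing_hasMulInverse.Build gpseries
  gp_mulVx gp_unitPl gp_inv_out.

Lemma gpseries_min f : f != 0 ->
  exists2 a, f a != 0 & forall s, f s != 0 -> a <= s.
Proof.
move=> f0; have := @no_infinite_descent_min _ _ _ (@coef_descent f) (@subset_refl _ _).
apply.
apply: contrapT => hn; move/eqP: f0; apply; apply: gpseriesP => s.
by apply/eqP; rewrite -[_ == _]negbK; apply/negP => fs; apply: hn; exists s.
Qed.

Fact gp_integral : GRing.integral_domain_axiom gpseries.
Proof.
move=> f h fh0; apply/negPn/negP; rewrite negb_or.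
move=> /andP[/gpseries_min[a fa amin] /gpseries_min[b hb bmin]].
have := convolution_min amin bmin; rewrite -gp_coefM fh0 gp_coef0 => /esym/eqP.
by rewrite mulf_eq0 (negPf fa) (negPf hb).
Qed.

HB.instance Definition _ := GRing.ComUnitRing_isIntegral.Build gpseries
  gp_integral.

End Nonneg.
Arguments gpseries : clear implicits.

Section FractionField.
Variables (G : oagType) (K : fieldType).

Definition monomial (s : G) : gpseries G K := insubd (0 : gpseries G K) (delta K s).

Lemma coef_monomial (s : G) : 0 <= s -> coef (monomial s) = delta K s.
Proof. by move=> s0; apply: insubdK; apply/mem_set/power_series_delta. Qed.

(* X^g in the quotient field of V; [insubd] in [monomial] gives the junk value 0
   for negative exponents, which are not used here. *)
Definition Xpow (g : G) : {fraction gpseries G K} :=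
  if 0 <= g then tofrac (monomial g) else (tofrac (monomial (- g)))^-1.

(* [[K^S]] inside the quotient field of V. *)
Definition gpring (S : set G) : set {fraction gpseries G K} :=
  [set tofrac f | f in [set f : gpseries G K | power_series S f]].

End FractionField.
Arguments monomial {G} K s.
Arguments Xpow {G} K g.
Arguments gpring {G} K S _.

Section Overrings.
Variable F : fieldType.

Definition quotient_field (D : set F) : set F :=
  [set z | exists x y, [/\ D x, D y, y != 0 & z = x / y]].

Definition overring (D R : set F) : Prop :=
  [/\ GRing.subring_closed [in R], D `<=` R & R `<=` quotient_field D].

Definition maximal_excluding (D : set F) (y : F) : Prop :=
  [/\ quotient_field D y, ~ D y &
      forall R : set F, overring D R -> D `<` R -> R y].

End Overrings.

Lemma gpring_subring (G : oagType) (K : fieldType) (S : set G) :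
  submonoid S -> GRing.subring_closed [in gpring K S].
Proof.
move=> hS; split.
- apply/mem_set; exists 1; last exact: tofrac1.
  by apply: power_series_delta; case: hS.
- move=> _ _ /set_mem[f hf <-] /set_mem[h hh <-]; apply/mem_set.
  exists (f - h); last exact: tofracB.
  exact: power_seriesD hf (power_seriesN hh).
- move=> _ _ /set_mem[f hf <-] /set_mem[h hh <-]; apply/mem_set.
  exists (f * h); last exact: tofracM.
  exact: power_series_convolution.
Qed.

(* Main.v *)
(* V is a valuation domain: a quotient x / y is built by gluing the partial
   solutions h of x = y * h, which are unique below every given exponent; an
   obstruction to prolonging them is removed by one more monomial.

   (1) => (2): if g and a - g are both outside S, the overrings [[K^(S + Ng)]] and
   [[K^(S + N(a - g))]] contain X^a, so a lies in S + ng and in S + m(a - g) with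
   n, m >= 2, whence 2g <= a and 2(a - g) <= a.

   (2) => (1): S contains every exponent > a.  Let z be in an overring R of D but
   not in D.  If z is not in V, then z = 1 / h with h of positive value, and
   X^a = z * (h X^a) with h X^a in D.  If z is in V, remove its terms with exponent
   in S; the rest e is in R and has a value g outside S, and e X^(a - g), or e^2 if
   2g = a, has value a, hence equals X^a up to a constant and an element of D. *)

Require Import Defs.
From mathcomp Require Import all_boot all_order all_algebra.
From mathcomp Require Import boolp classical_sets functions cardinality fsbigop.

Import Order.TTheory GRing.Theory.
Local Open Scope classical_set_scope.
Local Open Scope ring_scope.

(** * Ordered groups, and adjoining one exponent to a submonoid *)

Section OrderedGroup.
Set Implicit Arguments.
Unset Strict Implicit.
Variable G : oagType.
Implicit Types x y z : G.

Lemma oag_leBl x y z : (x - y <= z) = (x <= y + z).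
Proof. by rewrite -(oag_leDl _ z y) (addrC y (x - y)) subrK. Qed.

Lemma oag_mulrn_ge0 x n : 0 <= x -> 0 <= x *+ n.
Proof.
by move=> x0; elim: n => // n IH; rewrite mulrS -[0]addr0; exact: oag_leD.
Qed.

Definition adjoin_exponent (S : set G) g : set G :=
  [set t | exists s n, S s /\ t = s + g *+ n].

Lemma submonoid_adjoin (S : set G) g :
  submonoid S -> submonoid (adjoin_exponent S g).
Proof.
move=> [S0 SD]; split; first by exists 0, 0%N; rewrite mulr0n addr0.
move=> _ _ [s [n [Ss ->]]] [t [m [St ->]]].
by exists (s + t), (n + m)%N; split; [exact: SD | rewrite mulrnDr addrACA].
Qed.

Lemma sub_adjoin (S : set G) g : S `<=` adjoin_exponent S g.
Proof. by move=> s Ss; exists s, 0%N; rewrite mulr0n addr0. Qed.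

Lemma mem_adjoin (S : set G) g : S 0 -> adjoin_exponent S g g.
Proof. by move=> S0; exists 0, 1%N; rewrite mulr1n add0r. Qed.

Lemma adjoin_nonneg (S : set G) g :
  S `<=` nonneg -> 0 <= g -> adjoin_exponent S g `<=` nonneg.
Proof.
move=> SV g0 _ [s [n [/SV s0 ->]]]; rewrite /nonneg /= -[0]addr0.
exact: oag_leD s0 (oag_mulrn_ge0 n g0).
Qed.

End OrderedGroup.

(** * Coefficients and supports of series *)

Section Series.
Set Implicit Arguments.
Unset Strict Implicit.
Variables (G : oagType) (K : fieldType).
Implicit Types (S T : set G) (f h x y : gpseries G K).

Lemma delta_neq0 (g s : G) : delta K g s != 0 -> s = g.
Proof. by rewrite /delta; case: (eqVneq s g) => //; rewrite mulr0n eqxx. Qed.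

Lemma delta_id (g : G) : delta K g g = 1.
Proof. by rewrite /delta eqxx. Qed.

Lemma coef_ge0 f s : f s != 0 -> 0 <= s.
Proof. by case: (coefP f) => fS _; exact: fS. Qed.

(** Elements of V already satisfy the descent condition, so only the support has to be located. *)
Lemma power_seriesW {S} f : (forall s, f s != 0 -> S s) -> power_series S f.
Proof. by move=> fS; split; [exact: fS | exact: coef_descent]. Qed.

Lemma power_series_const (c : K) :
  power_series (@nonneg G) (fun s => c * delta K 0 s).
Proof.
have [d0 dd] := @power_series_delta G K nonneg 0 (lexx 0).
have sub s : c * delta K 0 s != 0 -> delta K 0 s != 0.
  by rewrite mulf_eq0 negb_or => /andP[].
by split=> [s /sub/d0 //|]; apply: sub_no_infinite_descent dd => s /sub.
Qed.

Definition gp_const c := mk_gpseries (power_series_const c).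

Lemma coef_const c s : gp_const c s = c * delta K 0 s. Proof. by []. Qed.

Lemma coef_constM c f s : (gp_const c * f) s = c * f s.
Proof.
rewrite gp_coefM (@convolution_widen _ _ _ _ _ [set 0]).
  by rewrite fsbig_set1 coef_const delta_id mulr1 subr0.
move=> u; rewrite coef_const mulf_eq0 negb_or => /andP[_ /delta_neq0 ->] //.
Qed.

Lemma gp_const_power_series S c : S 0 -> power_series S (gp_const c).
Proof.
move=> S0; apply: power_seriesW => s.
by rewrite coef_const mulf_eq0 negb_or => /andP[_ /delta_neq0 ->].
Qed.

Lemma coefM_ge f h (p q : G) : (forall s, f s != 0 -> p <= s) ->
  (forall s, h s != 0 -> q <= s) -> forall s, (f * h) s != 0 -> p + q <= s.
Proof.
move=> fp hq s; rewrite gp_coefM => /convolution_neq0[u [w [fu hw <-]]].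
exact: oag_leD (fp _ fu) (hq _ hw).
Qed.

Lemma monomial_ge (g : G) : 0 <= g -> forall s, monomial K g s != 0 -> g <= s.
Proof. by move=> g0 s; rewrite coef_monomial // => /delta_neq0 ->. Qed.

(** * Division of series *)

Lemma coefM_eq0_below y h (q t : G) : (forall s, y s != 0 -> q <= s) ->
  (forall s, s <= t -> h s = 0) -> forall s, s <= q + t -> (y * h) s = 0.
Proof.
move=> yq ht s st; apply/eqP/negPn/negP; rewrite gp_coefM.
move=> /convolution_neq0[u [w [yu hw us]]]; move/negP: hw; apply.
apply/eqP/ht; rewrite -(oag_leDl _ _ q); apply: le_trans st.
by rewrite -us; apply: oag_leD (yq _ yu) (lexx _).
Qed.

(** Otherwise the least exponent [m] of [h] would give [y * h] the nonzero coefficient [y q * h m]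
    at [q + m <= q + t]. This makes partial quotients unique. *)
Lemma coef_eq0_belowM y h (q t : G) : y q != 0 ->
  (forall s, y s != 0 -> q <= s) ->
  (forall s, s <= q + t -> (y * h) s = 0) -> forall s, s <= t -> h s = 0.
Proof.
move=> yq yqmin yh0 s st; apply/eqP/negPn/negP => hs.
have h0 : h != 0 by apply/eqP => e; move: hs; rewrite e gp_coef0 eqxx.
have [m hm mmin] := gpseries_min h0.
have := convolution_min yqmin mmin; rewrite -gp_coefM yh0 ?oag_leDl.
  by move/esym/eqP; rewrite mulf_eq0 (negPf yq) (negPf hm).
exact: le_trans (mmin _ hs) st.
Qed.

Lemma gpseries_dvd x y (q : G) : y q != 0 -> (forall s, y s != 0 -> q <= s) ->
  (forall s, x s != 0 -> q <= s) -> exists h, x = y * h.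
Proof.
move=> yq yqmin xq.
(* A partial quotient must be correct up to [q + t], not [t]: as [y] has value [q], this determines
   [h] exactly up to [t]. *)
pose good t h := forall s, s <= q + t -> (x - y * h) s = 0.
have goodE t h h' : good t h -> good t h' -> forall s, s <= t -> h s = h' s.
  move=> gh gh' s st; apply/eqP; rewrite -subr_eq0; apply/eqP.
  apply: (@coef_eq0_belowM y (h - h') q t yq yqmin _ s st) => r rt.
  have -> : y * (h - h') = (x - y * h') - (x - y * h).
    by rewrite mulrBr opprB [RHS]addrC addrA subrK.
  by rewrite gp_coefD gp_coefN gh // gh' // subrr.
have goodW t t' h : t' <= t -> good t h -> good t' h.
  by move=> t't gh s st; apply: gh; apply: le_trans st _; rewrite oag_leDl.
(* The coefficient at [t] is read off any partial quotient good at [t]; by [goodE] the choice does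
   not matter. Where none exists, the default 0 truncates [H]. *)
pose H t := if pselect (exists h, good t h) is left e then projT1 (cid e) t else 0.
have HE t h : good t h -> forall s, s <= t -> H s = h s.
  move=> gh s st; have gs := goodW _ _ _ st gh.
  rewrite /H; case: pselect => [e|[]]; last by exists h.
  by case: (cid e) => h' /= gh'; exact: goodE gh' gs _ (lexx s).
have Hgood t : H t != 0 -> exists h, good t h.
  by rewrite /H; case: pselect => //; rewrite eqxx.
have HV : power_series nonneg H.
  split=> [t /= Ht|[u hu]].
    have [h gh] := Hgood _ Ht.
    by move: Ht; rewrite (HE _ _ gh _ (lexx t)); exact: coef_ge0.
  (* A descending sequence in the support stays below its first term, where [H] agrees with a single
     series. *)
  have [h gh] : exists h, good (u 0%N) h by apply: Hgood; have [] := hu 0%N.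
  have ule n : u n <= u 0%N.
    by elim: n => // n; apply: le_trans; apply: ltW; have [] := hu n.
  apply: (@coef_descent _ _ h); exists u => n; have [Hu ?] := hu n.
  by split=> //=; rewrite -(HE _ _ gh _ (ule n)).
pose h := mk_gpseries HV; exists h.
apply/eqP; rewrite -subr_eq0; apply/negPn/negP => d0.
have [m dm mmin] := gpseries_min d0.
have qm : q <= m.
  have [xm|/xq //] := eqVneq (x m) 0.
  move: dm; rewrite gp_coefD xm add0r gp_coefN oppr_eq0.
  rewrite gp_coefM => /convolution_neq0[u [w [yu hw <-]]].
  by rewrite -[q]addr0; apply: oag_leD (yqmin _ yu) (@coef_ge0 h _ hw).
have b0 : 0 <= m - q by rewrite -(oag_leDl _ _ q) addr0 addrC subrK.
(* A good [k] agrees with [H] up to [m - q], so [y * k] and [y * h] agree up to [m], and [x - y * h]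
   would vanish at [m]. *)
have ngood k : ~ good (m - q) k.
  move=> gk; move/negP: dm; apply; apply/eqP.
  have -> : x - y * h = (x - y * k) - y * (h - k).
    by rewrite mulrBr opprB addrA subrK.
  have mE : m <= q + (m - q) by rewrite addrC subrK.
  rewrite gp_coefD gp_coefN gk // (@coefM_eq0_below y _ q (m - q)) ?subrr //.
  move=> s sm; rewrite gp_coefD gp_coefN -(HE _ _ gk _ sm) /=.
  exact: subrr.
(* This constant cancels the coefficient at [m], so the corrected series is good at [m - q],
   contradicting [ngood]. *)
pose c := (x - y * h) m / y q.
apply: (ngood (h + gp_const c * monomial K (m - q))) => s.
rewrite (addrC q) subrK => sm.
rewrite mulrDr opprD addrA gp_coefD gp_coefN mulrCA coef_constM.
have [sltm|] := boolP (s < m).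
  have -> : (x - y * h) s = 0.
    by apply/eqP/negPn/negP => /mmin; rewrite oag_leNgt sltm.
  have -> : (y * monomial K (m - q)) s = 0.
    apply/eqP/negPn/negP => /(coefM_ge yqmin (monomial_ge b0)).
    by rewrite addrC subrK oag_leNgt sltm.
  by rewrite mulr0 subrr.
rewrite -oag_leNgt => ms; have -> : s = m by apply/le_anti; rewrite sm ms.
have -> : (y * monomial K (m - q)) m = y q.
  have := convolution_min yqmin (monomial_ge b0).
  by rewrite -gp_coefM coef_monomial // delta_id mulr1 (addrC q) subrK.
by rewrite /c divfK // subrr.
Qed.

(** * The rings [[K^S]] inside the quotient field of V *)

Lemma gpring_Xpow S g : S `<=` nonneg -> gpring K S (Xpow K g) <-> S g.
Proof.
move=> SV; split=> [|Sg]; last first.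
  have g0 : 0 <= g := SV _ Sg.
  rewrite /Xpow g0; exists (monomial K g) => //.
  by rewrite /= coef_monomial //; exact: power_series_delta.
rewrite /Xpow; case: (boolP (0 <= g)) => [g0|].
  move=> [f [fS _] /eqP]; rewrite tofrac_eq => /eqP fE; apply: fS.
  by rewrite /= fE coef_monomial // delta_id oner_neq0.
(* For [g < 0], the coefficient at 0 in [f * X^(-g) = 1] puts [g] in the support of [f], hence among
   the nonnegative exponents. *)
rewrite -oag_ltNge => g0 [f [fS _] fE]; exfalso.
have Ng0 : 0 <= - g by rewrite -[0]oppr0 oag_leN ltW.
have m0 : monomial K (- g) != 0.
  apply/eqP => /(congr1 (fun h : gpseries G K => h (- g))) /eqP.
  by rewrite coef_monomial // delta_id gp_coef0 oner_eq0.
have /eqP : tofrac (f * monomial K (- g)) = 1.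
  by rewrite tofracM fE mulVf // tofrac_eq0.
rewrite -tofrac1 tofrac_eq => /eqP fm.
have : (f * monomial K (- g)) 0 != 0 by rewrite fm gp_coef1 delta_id oner_neq0.
rewrite gp_coefM => /convolution_neq0[u [w [fu]]].
rewrite coef_monomial // => /delta_neq0 -> /eqP; rewrite subr_eq0 => /eqP ug.
by move: (SV _ (fS _ fu)); rewrite /nonneg /= ug oag_leNgt g0.
Qed.

Lemma sub_gpring S T : S `<=` T -> gpring K S `<=` gpring K T.
Proof.
move=> ST _ [f [fS fd] <-]; exists f => //; split=> //.
exact: subset_trans fS ST.
Qed.

Lemma gpring_quotient_field S :
  submonoid S -> gpring K S `<=` quotient_field (gpring K S).
Proof.
move=> hS z Dz; exists z, 1; split=> //; rewrite ?oner_neq0 ?divr1 //.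
by have [/set_mem] := gpring_subring K hS.
Qed.

(** * From maximality to the condition on exponents *)

Section MaximalExcluding.
Variable S : set G.
Hypotheses (S_submonoid : submonoid S) (S_nonneg : S `<=` nonneg).
Hypothesis same_quotient_field :
  quotient_field (gpring K S) = quotient_field (gpring K nonneg).

Lemma maximal_excluding_exponent (a g : G) :
  maximal_excluding (gpring K S) (Xpow K a) -> ~ S a -> 0 <= g -> ~ S g ->
  exists s n, S s /\ a = s + g *+ n.+1.
Proof.
move=> [_ _ maxD] Sa g0 Sg.
have S'V := adjoin_nonneg S_nonneg g0.
have /(maxD _) : overring (gpring K S) (gpring K (adjoin_exponent S g)).
  split; first exact: gpring_subring (submonoid_adjoin g S_submonoid).
    exact: sub_gpring (@sub_adjoin _ S g).
  (* Equality of the quotient fields keeps the larger ring inside the quotient field of D. *)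
  rewrite same_quotient_field.
  apply: subset_trans (gpring_quotient_field (nonneg_submonoid G)).
  exact: sub_gpring.
case.
  split; first exact: sub_gpring (@sub_adjoin _ S g).
  move=> /(_ (Xpow K g)); rewrite !gpring_Xpow // => h; apply/Sg/h.
  by apply: mem_adjoin; case: S_submonoid.
move=> f fS fE.
have : gpring K (adjoin_exponent S g) (Xpow K a) by exists f.
rewrite gpring_Xpow // => -[s [[|n] [Ss e]]]; last by exists s, n.
by case: Sa; rewrite e mulr0n addr0.
Qed.

Lemma maximal_excluding_compl (a g : G) :
  0 <= a -> maximal_excluding (gpring K S) (Xpow K a) -> ~ S a ->
  g *+ 2 <> a -> ~ S (a - g) -> S g.
Proof.
move=> a0 maxD Sa g2 Sag; apply: contrapT => Sg.
have le_a b : 0 <= b -> ~ S b -> ~ S (a - b) -> b *+ 2 <= a.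
  move=> b0 Sb Sab.
  have [s [[|n] [Ss e]]] := maximal_excluding_exponent maxD Sa b0 Sb.
    (* A multiple [1 b] would give [a - b = s] in [S]; so at least [2 b] occurs, and the remaining
       terms are nonnegative. *)
    by case: Sab; rewrite e mulr1n addrK.
  rewrite e -(addn2 n) mulrnDr addrA -[X in X <= _]add0r.
  apply: oag_leD (lexx _); rewrite -[0]addr0.
  exact: oag_leD (S_nonneg Ss) (oag_mulrn_ge0 n b0).
have le_a1 b : 0 <= b -> ~ S b -> ~ S (a - b) -> b <= a.
  move=> b0 Sb Sab; apply: le_trans (le_a _ b0 Sb Sab).
  by rewrite mulr2n -[X in X <= _]addr0 oag_leDl.
have Sg' : ~ S (a - (a - g)) by rewrite subKr.
have [g0|] := boolP (0 <= g); last first.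
  (* A negative [g] would make [a - g > a], against [le_a1] at [a - g]. *)
  rewrite -oag_ltNge => g0.
  have ag : a < a - g by rewrite -[X in X < _]addr0 oag_ltDl -[0]oppr0 oag_ltN.
  have := le_a1 _ (ltW (le_lt_trans a0 ag)) Sag Sg'.
  by rewrite oag_leNgt ag.
have ga := le_a1 _ g0 Sg Sag.
have ag0 : 0 <= a - g by rewrite -(oag_leDl _ _ g) addr0 addrC subrK.
(* [le_a] at [g] and at [a - g] gives [2g <= a] and [2a - 2g <= a], so [2g = a]. *)
apply: g2; apply/le_anti; rewrite le_a //=.
have := le_a _ ag0 Sag Sg'.
by rewrite mulrnBl oag_leBl (mulr2n a) (addrC (g *+ 2)) oag_leDl.
Qed.

(** * From the condition on exponents to maximality *)

Lemma overring_leading_monomial (R : set {fraction gpseries G K}) (a : G) f :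
  GRing.subring_closed [in R] -> gpring K S `<=` R -> 0 <= a ->
  (forall s, a < s -> S s) -> f a != 0 -> (forall s, f s != 0 -> a <= s) ->
  R (tofrac f) -> R (Xpow K a).
Proof.
move=> [_ RB RM] DR a0 aS fa fmin Rf.
(* Normalising the leading coefficient to 1 leaves only exponents [> a] in [d]; these lie in [S], so
   [d] is in D. *)
pose c := gp_const (f a)^-1; pose d := c * f - monomial K a.
have Rc : R (tofrac c).
  apply: DR; exists c => //; apply: gp_const_power_series.
  by case: S_submonoid.
have Rd : R (tofrac d).
  apply: DR; exists d => //; apply: power_seriesW => s.
  rewrite /d gp_coefD gp_coefN coef_constM coef_monomial //.
  have [->|sa] := eqVneq s a; first by rewrite delta_id mulVf // subrr eqxx.
  have -> : delta K a s = 0.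
    by apply/eqP/negPn/negP => /delta_neq0 e; rewrite e eqxx in sa.
  rewrite subr0 mulf_eq0 negb_or => /andP[_ /fmin as_].
  by apply: aS; rewrite lt_neqAle eq_sym sa.
have -> : Xpow K a = tofrac c * tofrac f - tofrac d.
  by rewrite /Xpow a0 -tofracM -tofracB /d subKr.
by apply/set_mem/RB; [apply: RM|]; exact: mem_set.
Qed.

(** All exponents of [h X^a] exceed [a], so it lies in D, and multiplying it by the inverse of [h]
    gives [X^a]. *)
Lemma overring_inverse (R : set {fraction gpseries G K}) (a b : G) h :
  GRing.subring_closed [in R] -> gpring K S `<=` R -> 0 <= a ->
  (forall s, a < s -> S s) -> 0 < b -> h != 0 ->
  (forall s, h s != 0 -> b <= s) -> R (tofrac h)^-1 -> R (Xpow K a).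
Proof.
move=> [_ _ RM] DR a0 aS b0 h0 hb Rh.
have -> : Xpow K a = (tofrac h)^-1 * tofrac (h * monomial K a).
  by rewrite tofracM mulKf ?tofrac_eq0 // /Xpow a0.
apply/set_mem/RM; apply: mem_set => //; apply: DR; exists (h * monomial K a) => //.
apply: power_seriesW => s /(coefM_ge hb (monomial_ge a0)) bas; apply: aS.
apply: lt_le_trans bas.
by rewrite addrC -[X in X < _]addr0 oag_ltDl.
Qed.

(** Restrict [f] to [S] and to its complement: the second piece is nonzero, and its least exponent
    is automatically outside [S]. *)
Lemma power_series_outside f : ~ power_series S f ->
  exists d e : gpseries G K, [/\ f = d + e, power_series S d &
    exists g, [/\ e g != 0, ~ S g & forall s, e s != 0 -> g <= s]].
Proof.
move=> nSf.
pose part (T : set G) s := if s \in T then f s else 0.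
have partV T : power_series nonneg (part T).
  have sub s : part T s != 0 -> f s != 0.
    by rewrite /part; case: ifP => //; rewrite eqxx.
  split=> [s /sub/coef_ge0 //|].
  by apply: sub_no_infinite_descent (@coef_descent _ _ f) => s /sub.
have partT T s : part T s != 0 -> T s.
  by rewrite /part; case: ifP => [/set_mem //|]; rewrite eqxx.
pose d := mk_gpseries (partV S); pose e := mk_gpseries (partV (~` S)).
have fE : f = d + e.
  apply: gpseriesP => s; rewrite gp_coefD /= /part in_setC.
  by case: (s \in S); rewrite ?addr0 ?add0r.
have Sd : power_series S d by apply: power_seriesW; exact: (partT S).
have e0 : e != 0.
  by apply/eqP => e0; apply: nSf; rewrite fE e0 addr0.
have [g eg gmin] := gpseries_min e0.
by exists d, e; split=> //; exists g; split=> //; exact: (partT (~` S)).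
Qed.

Lemma compl_maximal_excluding (a : G) : 0 <= a -> ~ S a ->
  (forall g, g *+ 2 <> a -> (S g <-> ~ S (a - g))) ->
  maximal_excluding (gpring K S) (Xpow K a).
Proof.
move=> a0 Sa compl.
(* For [s > a] the exponent [a - s] is negative, hence outside [S], and [2s >= s > a] rules out the
   exceptional case of [compl]. *)
have aS s : a < s -> S s.
  move=> lt_as; have s0 := ltW (le_lt_trans a0 lt_as).
  apply/compl.
    move=> e; move: lt_as; rewrite -e oag_ltNge mulr2n.
    by rewrite -[X in X <= _]addr0 oag_leDl s0.
  move=> /S_nonneg; rewrite /nonneg /= -(oag_leDl _ _ s) addr0 (addrC s) subrK.
  by rewrite oag_leNgt lt_as.
split; last first.
- move=> R [Rring DR RQ] [_ /existsNP[z /not_implyP[Rz Dz]]].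
  have := RQ _ Rz; rewrite same_quotient_field.
  move=> [_ [_ [[x _ <-] [y _ <-]]]]; rewrite tofrac_eq0 => y0 zE.
  have x0 : x != 0.
    apply/eqP => x0; apply: Dz; rewrite zE x0 tofrac0 mul0r.
    by exists 0; rewrite /= ?tofrac0 //; exact: power_series0.
  have [p xp xmin] := gpseries_min x0; have [q yq ymin] := gpseries_min y0.
  (* The value of [z] is [p - q]; when it is negative, [x] divides [y] and [z] is the inverse of a
     series of positive value. *)
  have [qp|] := boolP (q <= p); last first.
    rewrite -oag_ltNge => pq.
    have [|h yE] := gpseries_dvd xp xmin (x := y).
      by move=> s /ymin; apply: le_trans; exact: ltW.
    have h0 : h != 0 by apply/eqP => h0; move: y0; rewrite yE h0 mulr0 eqxx.
    have [b hb hmin] := gpseries_min h0.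
    have zV : z = (tofrac h)^-1.
      by rewrite zE yE tofracM invfM mulVKf // tofrac_eq0.
    apply: (overring_inverse Rring DR a0 aS _ h0 hmin); last by rewrite -zV.
    rewrite -(oag_ltDl _ _ p) addr0; apply: lt_le_trans pq _; apply: ymin.
    by rewrite yE gp_coefM (convolution_min xmin hmin) mulf_neq0.
  have [|f xE] := gpseries_dvd yq ymin (x := x).
    by move=> s /xmin; exact: le_trans.
  have zf : z = tofrac f by rewrite zE xE tofracM mulrC mulKf // tofrac_eq0.
  have [|d [e [fE Sd [g [eg Sg gmin]]]]] := @power_series_outside f.
    by move=> Sf; apply: Dz; exists f.
  have [_ RB RM] := Rring.
  have Re : R (tofrac e).
    have -> : tofrac e = z - tofrac d by rewrite zf fE tofracD addrC addKr.
    by apply/set_mem/RB; apply: mem_set => //; apply: DR; exists d.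
  have g0 := coef_ge0 eg.
  case: (pselect (g *+ 2 = a)) => [ga|ga].
    apply: (overring_leading_monomial (f := e * e) Rring DR a0 aS).
    - by rewrite -ga mulr2n gp_coefM (convolution_min gmin gmin) mulf_neq0.
    - by rewrite -ga mulr2n; exact: coefM_ge.
    - by rewrite tofracM; apply/set_mem/RM; exact: mem_set.
  (* As [g] is outside [S], [compl] supplies the multiplier [X^(a - g)] in D that raises the value
     of [e] to [a]. *)
  have Sag : S (a - g) by apply: contrapT => /(compl _ ga).
  have ag0 : 0 <= a - g := S_nonneg Sag.
  have agE : a = (a - g) + g by rewrite subrK.
  apply: (overring_leading_monomial (f := monomial K (a - g) * e) Rring DR a0 aS).
  - rewrite [X in coef _ X]agE gp_coefM (convolution_min (monomial_ge ag0) gmin).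
    by rewrite coef_monomial // delta_id mul1r.
  - move=> s es; rewrite [X in X <= _]agE.
    exact: (coefM_ge (monomial_ge ag0) gmin).
  - rewrite tofracM; apply/set_mem/RM; apply: mem_set => //; apply: DR.
    exists (monomial K (a - g)) => //=; rewrite coef_monomial //.
    exact: power_series_delta.
- by move/gpring_Xpow => /(_ S_nonneg).
- rewrite same_quotient_field; apply: gpring_quotient_field.
    exact: nonneg_submonoid.
  exact/gpring_Xpow.
Qed.

End MaximalExcluding.

End Series.

Theorem theorem3p3 (G : oagType) (K : fieldType) (S : set G)
    (S_submonoid : submonoid S) (S_proper : S `<` nonneg)
    (same_quotient_field :
      quotient_field (gpring K S) = quotient_field (gpring K nonneg))
    (a : G) (a_ge0 : 0 <= a) (aNS : ~ S a) :
  maximal_excluding (gpring K S) (Xpow K a) <->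
  forall g : G, g *+ 2 <> a ->
    (gpring K S (Xpow K g) <-> ~ gpring K S (Xpow K (a - g))).
Proof.
have [SV _] := S_proper; have [_ SD] := S_submonoid.
split=> [maxD g g2|compl]; last first.
  apply: compl_maximal_excluding => // g g2.
  by rewrite -!(gpring_Xpow K _ SV); exact: compl.
rewrite !gpring_Xpow //; split=> [Sg Sag|].
  (* If [g] and [a - g] were both in [S], so would be their sum [a]. *)
  by apply: aNS; rewrite -(subrK g a); exact: SD.
exact: (maximal_excluding_compl S_submonoid SV same_quotient_field).
Qed.
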